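(* Let $\Lambda>1$. There exist constants $\alpha\in(0,1)$ and $C>1$ depending only on $\Lambda$ such that the following holds. For every function $a=a(x,v)$ on $Q_2$ satisfying $\Lambda^{-1}\le a\le\Lambda$ and every classical solution $f=f(x,v)$ in $Q_2$ of $$v\,\partial_x f=a\,\partial_{vv}f,$$ one has $$\|f\|_{C^\alpha(Q_1)}\le C\,\|f\|_{L^\infty(Q_2)}.$$
   Context: Here $(x,v)\in\mathbb{R}\times\mathbb{R}$, and for $r>0$, $Q_r:=\{(x,v)\in\mathbb{R}\times\mathbb{R}:\ |x|<r^3,\ |v|<r\}$. No continuity or small-oscillation condition is imposed on the coefficient $a$. A classical solution of $v\,\partial_xf=a\,\partial_{vv}f$ in an open set is a real-valued function $f$ that is continuously differentiable in $x$ and twice continuously differentiable in $v$ (i.e. $f,\partial_xf,\partial_vf,\partial_{vv}f$ exist and are continuous) and satisfies the equation pointwise there. The Hölder norm is the usual one: $\|f\|_{C^\alpha(Q)}:=\sup_{Q}|f|+\sup_{z\ne z'\in Q}\frac{|f(z)-f(z')|}{|z-z'|^\alpha}$, with $|\cdot|$ the Euclidean norm on $\mathbb{R}^2$. *)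

(* Defs.v *)
From HB Require Import structures.
From mathcomp Require Import all_boot all_order all_algebra.
From mathcomp Require Import all_classical all_reals all_analysis.
Set Implicit Arguments.
Unset Strict Implicit.
Unset Printing Implicit Defensive.
Import Order.TTheory GRing.Theory Num.Theory.
Import numFieldNormedType.Exports.
Local Open Scope classical_set_scope.
Local Open Scope ring_scope.

Section Defs.
Context {R : realType}.
Implicit Types (f a : R * R -> R) (Q U : set (R * R)).

Definition cyl (r : R) : set (R * R) :=
  [set z | `|z.1| < r ^+ 3 /\ `|z.2| < r].

Definition ex : R * R := (1, 0).
Definition ev : R * R := (0, 1).

(* Functions are total on [R * R]. When [U] is open, the conditions below only
   involve the values of [a] and [f] in [U]. *)
Definition classical_solution U a f : Prop :=
  [/\ forall z, U z -> {for z, continuous f},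
      forall z, U z -> derivable f z ex /\ {for z, continuous ('D_ex f)},
      forall z, U z -> derivable f z ev /\ {for z, continuous ('D_ev f)},
      forall z, U z -> derivable ('D_ev f) z ev /\
                       {for z, continuous ('D_ev ('D_ev f))} &
      forall z, U z -> z.2 * 'D_ex f z = a z * 'D_ev ('D_ev f) z].

(* The library norm of [R * R] is the maximum norm. *)
Definition euclid (z : R * R) : R := Num.sqrt (z.1 ^+ 2 + z.2 ^+ 2).

Local Open Scope ereal_scope.

Definition sup_norm Q f : \bar R := ereal_sup [set `|f z|%:E | z in Q].

Definition holder_seminorm (alpha : R) Q f : \bar R :=
  ereal_sup [set (`|f p.1 - f p.2| / euclid (p.1 - p.2) `^ alpha)%R%:E |
             p in [set p | [/\ Q p.1, Q p.2 & p.1 != p.2]]].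

(* These norms are [+oo] when the corresponding supremum is infinite. *)
Definition holder_norm (alpha : R) Q f : \bar R :=
  sup_norm Q f + holder_seminorm alpha Q f.

Definition Linfty_norm Q f : \bar R :=
  'N[lebesgue_measure \x lebesgue_measure]_+oo[EFin \o (f \_ Q)].

End Defs.

(* Main.v *)
Require Import Defs.
From HB Require Import structures.
From mathcomp Require Import all_boot all_order all_algebra.
From mathcomp Require Import all_classical all_reals all_analysis.
From mathcomp Require Import ess_sup_inf ring lra.
Import Order.TTheory GRing.Theory Num.Theory.
Import numFieldNormedType.Exports.
Local Open Scope classical_set_scope.
Local Open Scope ring_scope.

(** Everything rests on the maximum principle with explicit barriers.  For
    [v > 0] the equation is a one-dimensional heat equation with time [x], and
    Kruzhkov's doubling of variables gives a Lipschitz bound in [v] without any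
    regularity of [a]; a Lipschitz bound in [v] gives a [1/2]-Hoelder bound in
    [x].  At the degenerate line [v = 0], suppose [-1 <= f <= 1] and, up to
    sign, [f (0, 1) <= 0].  By the Lipschitz bound [f <= 1/2] on a short
    segment of [{x = 0}] around [v = 1].  One barrier carries a gain
    [f <= 1 - theta] forward along [{v = 1}] over a long range of [x], a second
    one brings it down across [v = 0].  Hence the oscillation decays
    geometrically on the kinetic cylinders centred on [{v = 0}].  For two points
    at distance [d = h ^ 6], this decay is used if [|v| <= h]; otherwise the
    parabolic estimates are used after the dilation
    [(x, v) -> (x0 + v0 ^ 3 x, v0 v)], which also covers [v0 < 0]. *)

(** * Pointwise Taylor expansions *)

Definition taylor1 {R : realType} (h : R -> R) (x p : R) : Prop :=
  forall e, 0 < e -> exists2 d, 0 < d &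
    forall t, `|t| < d -> `|h (x + t) - h x - p * t| <= e * `|t|.

(** An expansion at the single point [x]: this is all that a touching barrier can see, and it
    survives differences, multiples and dilations. *)
Definition taylor2 {R : realType} (h : R -> R) (x g q : R) : Prop :=
  forall e, 0 < e -> exists2 d, 0 < d &
    forall t, `|t| < d -> `|h (x + t) - h x - g * t - q * t ^+ 2| <= e * t ^+ 2.

Lemma taylor1B {R : realType} (h k : R -> R) (x p q : R) :
  taylor1 h x p -> taylor1 k x q -> taylor1 (fun y => h y - k y) x (p - q).
Proof.
move=> th tk e e0.
have e20 : 0 < e / 2 by rewrite divr_gt0.
have [d1 d10 H1] := th _ e20; have [d2 d20 H2] := tk _ e20.
exists (Num.min d1 d2); first by rewrite lt_min d10.
move=> t; rewrite lt_min => /andP[/H1 + /H2].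
by rewrite !ler_norml => /andP[? ?] /andP[? ?]; apply/andP; split; lra.
Qed.

Lemma taylor2B {R : realType} (h k : R -> R) (x g q g' q' : R) :
  taylor2 h x g q -> taylor2 k x g' q' ->
  taylor2 (fun y => h y - k y) x (g - g') (q - q').
Proof.
move=> th tk e e0.
have e20 : 0 < e / 2 by rewrite divr_gt0.
have [d1 d10 H1] := th _ e20; have [d2 d20 H2] := tk _ e20.
exists (Num.min d1 d2); first by rewrite lt_min d10.
move=> t; rewrite lt_min => /andP[/H1 + /H2].
by rewrite !ler_norml => /andP[? ?] /andP[? ?]; apply/andP; split; lra.
Qed.

Lemma taylor1Z {R : realType} (h : R -> R) (c x p : R) :
  taylor1 h x p -> taylor1 (fun y => c * h y) x (c * p).
Proof.
move=> th e e0.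
have c0 : 0 < `|c| + 1 by rewrite ltr_pwDr.
have [d d0 H] := th _ (divr_gt0 e0 c0).
exists d => // t /H Ht.
have -> : c * h (x + t) - c * h x - c * p * t = c * (h (x + t) - h x - p * t) by ring.
rewrite normrM; apply: (le_trans (y := (`|c| + 1) * `|h (x + t) - h x - p * t|)).
  by rewrite ler_wpM2r// lerDl.
apply: (le_trans (y := (`|c| + 1) * (e / (`|c| + 1) * `|t|))).
  by rewrite ler_wpM2l// ltW.
by rewrite mulrA [_ * (e / _)]mulrC divfK// gt_eqF.
Qed.

Lemma taylor2Z {R : realType} (h : R -> R) (c x g q : R) :
  taylor2 h x g q -> taylor2 (fun y => c * h y) x (c * g) (c * q).
Proof.
move=> th e e0.
have c0 : 0 < `|c| + 1 by rewrite ltr_pwDr.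
have [d d0 H] := th _ (divr_gt0 e0 c0).
exists d => // t /H Ht.
have -> : c * h (x + t) - c * h x - c * g * t - c * q * t ^+ 2 =
  c * (h (x + t) - h x - g * t - q * t ^+ 2) by ring.
rewrite normrM.
apply: (le_trans (y := (`|c| + 1) * `|h (x + t) - h x - g * t - q * t ^+ 2|)).
  by rewrite ler_wpM2r// lerDl.
apply: (le_trans (y := (`|c| + 1) * (e / (`|c| + 1) * t ^+ 2))).
  by rewrite ler_wpM2l// ltW.
by rewrite mulrA [_ * (e / _)]mulrC divfK// gt_eqF.
Qed.

Lemma taylor1_poly {R : realType} (h : R -> R) (x p k : R) :
  (forall t, h (x + t) = h x + p * t + k * t ^+ 2) -> taylor1 h x p.
Proof.
move=> H e e0; have k0 : 0 < `|k| + 1 by rewrite ltr_pwDr.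
exists (e / (`|k| + 1)); first exact: divr_gt0.
move=> t; rewrite ltr_pdivlMr// => te; rewrite H.
have -> : h x + p * t + k * t ^+ 2 - h x - p * t = k * t * t by ring.
rewrite normrM ler_wpM2r// normrM; have := normr_ge0 t; have := normr_ge0 k; nra.
Qed.

Lemma taylor2_poly {R : realType} (h : R -> R) (x g q k l : R) :
  (forall t, h (x + t) = h x + g * t + q * t ^+ 2 + k * t ^+ 3 + l * t ^+ 4) ->
  taylor2 h x g q.
Proof.
move=> H e e0; have k0 : 0 < `|k| + `|l| + 1 by rewrite ltr_pwDr// addr_ge0.
exists (Num.min 1 (e / (`|k| + `|l| + 1))).
  by rewrite lt_min ltr01 divr_gt0.
move=> t; rewrite lt_min ltr_pdivlMr// => /andP[t1 te]; rewrite H.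
have -> : h x + g * t + q * t ^+ 2 + k * t ^+ 3 + l * t ^+ 4 - h x - g * t
  - q * t ^+ 2 = (k * t + l * t ^+ 2) * t ^+ 2 by ring.
rewrite normrM [`|t ^+ 2|]ger0_norm ?sqr_ge0// ler_wpM2r ?sqr_ge0//.
apply: (le_trans (ler_normD _ _)).
have -> : `|l * t ^+ 2| = `|l| * `|t| ^+ 2 by rewrite normrM normrX.
rewrite normrM.
have := normr_ge0 t; have := normr_ge0 k; have := normr_ge0 l.
set T := `|t| in t1 te *; set K := `|k| in te *; set L := `|l| in te *.
move=> L0 K0 T0.
have : L * T ^+ 2 <= L * T by rewrite ler_wpM2l// expr2; nra.
nra.
Qed.

Lemma taylor1_max_left {R : realType} (h : R -> R) (x p d0 : R) :
  0 < d0 -> taylor1 h x p ->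
  (forall t, 0 < t < d0 -> h (x - t) <= h x) -> 0 <= p.
Proof.
move=> d00 th H; rewrite leNgt; apply/negP => p0.
have e0 : 0 < - p / 2 by lra.
have [d dp Hd] := th _ e0.
pose t := Num.min d d0 / 2.
have m0 : 0 < Num.min d d0 by rewrite lt_min dp.
have t0 : 0 < t by rewrite divr_gt0.
have tm : t < Num.min d d0 by rewrite /t; lra.
have /andP[td td0] : (t < d) && (t < d0) by rewrite -lt_min.
have /Hd : `|- t| < d by rewrite normrN gtr0_norm.
rewrite normrN (gtr0_norm t0) ler_norml => /andP[+ _].
have := H t; rewrite t0 td0 => /(_ isT); nra.
Qed.

Lemma taylor1_max_right {R : realType} (h : R -> R) (x p d0 : R) :
  0 < d0 -> taylor1 h x p ->
  (forall t, 0 < t < d0 -> h (x + t) <= h x) -> p <= 0.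
Proof.
move=> d00 th H; rewrite leNgt; apply/negP => p0.
have e0 : 0 < p / 2 by lra.
have [d dp Hd] := th _ e0.
pose t := Num.min d d0 / 2.
have m0 : 0 < Num.min d d0 by rewrite lt_min dp.
have t0 : 0 < t by rewrite divr_gt0.
have tm : t < Num.min d d0 by rewrite /t; lra.
have /andP[td td0] : (t < d) && (t < d0) by rewrite -lt_min.
have /Hd : `|t| < d by rewrite gtr0_norm.
rewrite (gtr0_norm t0) ler_norml => /andP[+ _].
have := H t; rewrite t0 td0 => /(_ isT); nra.
Qed.

Lemma taylor2_max {R : realType} (h : R -> R) (x g q d0 : R) :
  0 < d0 -> taylor2 h x g q ->
  (forall t, `|t| < d0 -> h (x + t) <= h x) -> q <= 0.
Proof.
move=> d00 th H; rewrite leNgt; apply/negP => q0.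
have e0 : 0 < q / 2 by lra.
have [d dp Hd] := th _ e0.
pose t := Num.min d d0 / 2.
have m0 : 0 < Num.min d d0 by rewrite lt_min dp.
have t0 : 0 < t by rewrite divr_gt0.
have tm : t < Num.min d d0 by rewrite /t; lra.
have /andP[td td0] : (t < d) && (t < d0) by rewrite -lt_min.
have nt : `|t| = t by rewrite gtr0_norm.
(* Adding the expansions at [t] and [- t] cancels the first-order term. *)
have := Hd t; have := Hd (- t); have := H t; have := H (- t).
rewrite !normrN !nt td td0 => /(_ isT) A /(_ isT) B /(_ isT) + /(_ isT).
rewrite !ler_norml sqrrN => /andP[C _] /andP[D _].
have : 0 < t ^+ 2 by rewrite exprn_gt0.
nra.
Qed.

Lemma derivable_taylor1 {R : realType} {V : normedModType R} (f : V -> R) (a v : V) :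
  derivable f a v -> taylor1 (fun t => f (t *: v + a)) 0 ('D_v f a).
Proof.
move=> df e e0.
have /cvgrPdist_le /(_ _ e0) := df; rewrite /= near_withinE.
move=> /nbhs_ballP[d /= d0 Hd]; exists d => // t td.
have [->|t0] := eqVneq t 0.
  by rewrite !add0r scale0r add0r mulr0 subr0 subrr normr0 mulr0.
have := Hd t; rewrite /ball/= sub0r normrN => /(_ td t0).
rewrite distrC /= add0r scale0r add0r => Ht.
rewrite [X in `|X|](_ : _ = (t^-1 * (f (t *: v + a) - f a) - 'D_v f a) * t); last first.
  by rewrite mulrBl mulrAC mulVf// mul1r.
by rewrite normrM ler_wpM2r.
Qed.

(** Taylor-Peano formula. The remainder [k] has a derivative of size at most [e] times that of [t]
    between [x] and [x + t], so the mean value theorem concludes; the sign of [t] decides the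
    orientation of the interval. *)
Lemma taylor2_is_derive {R : realType} (h h' : R -> R) (x q d0 : R) :
  0 < d0 -> (forall t, `|t| < d0 -> is_derive (x + t) 1 h (h' (x + t))) ->
  taylor1 h' x q -> taylor2 h x (h' x) (q / 2).
Proof.
move=> d00 hd th e e0; have [d dp Hd] := th _ e0.
exists (Num.min d d0); first by rewrite lt_min dp.
move=> t; rewrite lt_min => /andP[td td0].
pose k y := h y - h' x * y - q / 2 * (y - x) ^+ 2.
have kd y : `|y - x| < d0 -> is_derive y 1 k (h' y - h' x - q * (y - x)).
  move=> yd; have := hd _ yd; rewrite addrC subrK => hdy.
  rewrite /k; apply: is_derive_eq; rewrite /GRing.scale/=; lra.
have kc a b : (forall y, y \in `[a, b] -> `|y - x| < d0) ->
    {within `[a, b], continuous k}.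
  by move=> H; apply: derivable_within_continuous => y /H/kd[].
have bnd c : `|c - x| <= `|t| ->
    `|(h' c - h' x - q * (c - x)) * t| <= e * t ^+ 2.
  move=> ct; rewrite normrM.
  have := Hd (c - x) (le_lt_trans ct td); rewrite [x + _]addrC subrK => H.
  have -> : t ^+ 2 = `|t| * `|t| by rewrite -normrM ger0_norm// -expr2 sqr_ge0.
  rewrite mulrA ler_wpM2r//; apply: (le_trans H); rewrite ler_wpM2l// ltW//.
have -> : h (x + t) - h x - h' x * t - q / 2 * t ^+ 2 = k (x + t) - k x.
  by rewrite /k; field.
have [tp|tn|->] := ltgtP t 0; last first.
- by rewrite !addr0 subrr normr0 expr0n mulr0.
- have inx y : y \in `[x, x + t] -> `|y - x| < d0.
    by rewrite in_itv/= => /andP[? ?]; move: td0; rewrite gtr0_norm// ger0_norm; lra.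
  have [|y yi|c] := @MVT _ k (fun y => h' y - h' x - q * (y - x)) x (x + t) _ _ (kc _ _ inx).
  + lra.
  + by apply: kd; apply: inx; move: yi; rewrite !in_itv/= => /andP[? ?]; lra.
  + rewrite in_itv/= => /andP[? ?] ->; rewrite [x + t]addrC addrK; apply: bnd.
    by rewrite !gtr0_norm//; lra.
have inx y : y \in `[x + t, x] -> `|y - x| < d0.
  by rewrite in_itv/= => /andP[? ?]; move: td0; rewrite ltr0_norm// ler0_norm; lra.
have [|y yi|c] := @MVT _ k (fun y => h' y - h' x - q * (y - x)) (x + t) x _ _ (kc _ _ inx).
- lra.
- by apply: kd; apply: inx; move: yi; rewrite !in_itv/= => /andP[? ?]; lra.
rewrite in_itv/= => /andP[? ?]; rewrite distrC => ->.
rewrite opprD addNKr mulrN normrN; apply: bnd.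
by rewrite !ltr0_norm//; lra.
Qed.

(* Since [taylor2] records the coefficient of [t ^ 2], [q] is half the second
   derivative, whence the factor 2 in the equation. *)
Definition solves_at {R : realType} (L : R) (f : R * R -> R) (z : R * R) : Prop :=
  {for z, continuous f} /\ exists p g q a,
    [/\ L^-1 <= a <= L, taylor1 (fun x => f (x, z.2)) z.1 p,
        taylor2 (fun v => f (z.1, v)) z.2 g q & z.2 * p = 2 * a * q].

(** * From classical to pointwise solutions *)

Lemma cyl_nbhs {R : realType} (r : R) (z : R * R) : cyl r z -> nbhs z (cyl r).
Proof.
move=> [z1 z2].
exists ([set x : R | `|x| < r ^+ 3], [set v : R | `|v| < r]) => //=; split.
  have := @near_in_itvoo R (- r ^+ 3) (r ^+ 3) z.1; rewrite in_itv/= -ltr_norml => /(_ z1).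
  by apply: filterS => x /=; rewrite in_itv/= ltr_norml.
have := @near_in_itvoo R (- r) r z.2; rewrite in_itv/= -ltr_norml => /(_ z2).
by apply: filterS => x /=; rewrite in_itv/= ltr_norml.
Qed.

Lemma classical_solves_at {R : realType} (L r : R) (a f : R * R -> R) :
  (forall z, cyl r z -> L^-1 <= a z <= L) ->
  classical_solution (cyl r) a f ->
  forall z, cyl r z -> solves_at L f z.
Proof.
move=> Ha [Hc Hx Hv Hvv Heq] z Uz; split; first exact: Hc.
exists ('D_ex f z), ('D_ev f z), ('D_ev ('D_ev f) z / 2), (a z).
move: z Uz => [x v] Uz.
have line t y : t *: (@ev R) + (x, y) = (x, t + y).
  by apply: injective_projections; rewrite /= /GRing.scale/= ?mulr0 ?mulr1 ?add0r.
split=> /=.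
- exact: Ha.
- have := derivable_taylor1 _ _ _ (Hx _ Uz).1.
  move=> H e /H[d d0 Hd]; exists d => // t /Hd.
  rewrite add0r scale0r add0r.
  have -> // : t *: ex + (x, v) = (x + t, v).
  by apply: injective_projections; rewrite /= /GRing.scale/= ?mulr0 ?mulr1 ?add0r 1?addrC.
(* [taylor2_is_derive] asks for the first [v]-derivative on a whole segment, which the open cylinder
   provides. *)
- have [d d0 Hd] : exists2 d, 0 < d & forall t, `|t| < d -> cyl r (x, v + t).
    move: (Uz) => [/= xr vr]; exists (r - `|v|); first by rewrite subr_gt0.
    by move=> t tv; split => //=; apply: (le_lt_trans (ler_normD _ _)); lra.
  apply: (taylor2_is_derive (fun y => f (x, y)) (fun y => 'D_ev f (x, y)) v
    ('D_ev ('D_ev f) (x, v)) d d0).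
    move=> t /Hd Ut; have /= [+ _] := Hv _ Ut => Hder.
    (* The difference quotients of [f] along [ev] are those of the one-variable function; this
       equality transfers both derivability and the value of the derivative. *)
    have E : (fun h => h^-1 *: ((f \o shift (x, v + t)) (h *: ev) - f (x, v + t))) =
      (fun h => h^-1 *: (((fun y => f (x, y)) \o shift (v + t)) (h *: 1) - f (x, v + t))).
      apply/funext => h; rewrite /= line; congr (_ *: (f (_, _) - _)).
      by rewrite /GRing.scale/= mulr1.
    apply: DeriveDef.
      by rewrite /derivable -E.
    by rewrite /derive -E.
  have := derivable_taylor1 _ _ _ (Hvv _ Uz).1.
  move=> H e /H[d1 d10 Hd1]; exists d1 => // t /Hd1.
  by rewrite add0r scale0r add0r line [t + v]addrC.
- by have /= -> := Heq _ Uz; field.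
Qed.

(** * Comparison principle and doubling of variables *)

Lemma continuous_sqr {R : realType} {T : topologicalType} (h : T -> R) (z : T) :
  {for z, continuous h} -> {for z, continuous (fun y => h y ^+ 2)}.
Proof. by move=> c; exact: (continuousM c c). Qed.

(** Boundary data are imposed on the sides in [v] and where characteristics enter: [x] is time for
    [v > 0] and reversed time for [v < 0]. At a positive maximum of [f - Phi] elsewhere, [q] is at
    most [Q] and [v * P] at most [v * p], which contradicts the equation for [f] combined with the
    strict inequality for [Phi]. [Q] is half the second [v]-derivative of [Phi]. *)
Lemma comparison {R : realType} (L x1 x2 v1 v2 : R) (f Phi P Q : R * R -> R) :
  let D (z : R * R) := x1 <= z.1 <= x2 /\ v1 <= z.2 <= v2 in
  0 < L ->
  (forall z, D z -> solves_at L f z) ->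
  (forall z, D z -> {for z, continuous Phi}) ->
  (forall z, D z -> taylor1 (fun x => Phi (x, z.2)) z.1 (P z)) ->
  (forall z, D z -> exists g, taylor2 (fun v => Phi (z.1, v)) z.2 g (Q z)) ->
  (forall z a, D z -> v1 < z.2 < v2 -> L^-1 <= a <= L ->
    2 * a * Q z < z.2 * P z) ->
  (forall z, D z -> [\/ z.2 = v1, z.2 = v2, z.1 = x1 /\ 0 <= z.2 |
     z.1 = x2 /\ z.2 <= 0] -> f z <= Phi z) ->
  forall z, D z -> f z <= Phi z.
Proof.
move=> D L0 Hf Hc HP HQ Hs Hb z0 Dz0; rewrite leNgt; apply/negP => fz0.
pose A := `[x1, x2] `*` `[v1, v2].
have AD z : A z -> D z by rewrite /A/D/=/setX/= !in_itv.
have DA z : D z -> A z by rewrite /A/D/=/setX/= !in_itv.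
have cA : compact A by apply: compact_setX; exact: segment_compact.
have cf : {within A, continuous (fun z => f z - Phi z)}.
  apply: continuous_in_subspaceT => z /set_mem/AD Dz.
  by apply: continuousB; [case: (Hf _ Dz)|exact: Hc].
have A0 : A !=set0 by exists z0; exact: DA.
have [z /set_mem/AD Dz zmax] := compact_EVT_max A0 cA cf.
have {}zmax y : D y -> f y - Phi y <= f z - Phi z.
  by move=> /DA/mem_set/zmax.
have fz : Phi z < f z by have := zmax _ Dz0; lra.
have {Hb} nb : ~ [\/ z.2 = v1, z.2 = v2, z.1 = x1 /\ 0 <= z.2 |
     z.1 = x2 /\ z.2 <= 0] by move=> /(Hb _ Dz); rewrite leNgt fz.
have [_ [p [g [q [a [Ha T1 T2 E]]]]]] := Hf _ Dz.
have T3 := HP _ Dz; have [g' T4] := HQ _ Dz.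
have {}Hs := Hs z a Dz.
move: z Dz zmax fz nb T1 T2 E T3 T4 Hs => [x v] [/= /andP[X1 X2] /andP[V1 V2]].
move=> zmax fz nb T1 T2 E T3 T4 Hs.
have v1v : v1 < v by rewrite lt_neqAle V1 andbT; apply/eqP => h; apply: nb; constructor 1.
have vv2 : v < v2 by rewrite lt_neqAle V2 andbT; apply/eqP => h; apply: nb; constructor 2.
have q0 : q - Q (x, v) <= 0.
  apply: (taylor2_max _ _ _ _ (Num.min (v - v1) (v2 - v)) _ (taylor2B _ _ _ _ _ _ _ T2 T4)) => [|t].
    by rewrite lt_min; lra.
  rewrite lt_min !ltr_norml => /andP[/andP[? ?] /andP[? ?]].
  by apply: zmax; rewrite /D/= X1 X2; split => //; apply/andP; split; lra.
(* The maximum may lie on the exit side, [x = x2] for [v > 0] or [x = x1] for [v < 0], so [x] is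
   moved only towards the entrance. For [v = 0] both members vanish. *)
have vp : v * P (x, v) <= v * p.
  have [v0|v0|->] := ltgtP v 0; last by rewrite !mul0r.
    have x2x : x < x2.
      by rewrite lt_neqAle X2 andbT; apply/eqP => h; apply: nb; constructor 4; split; lra.
    have : p - P (x, v) <= 0.
      apply: (taylor1_max_right _ _ _ (x2 - x) _ (taylor1B _ _ _ _ _ T1 T3)); first by lra.
      move=> t /andP[? ?]; apply: zmax; rewrite /D/= V1 V2; split => //;
        apply/andP; split; lra.
    nra.
  have x1x : x1 < x.
    by rewrite lt_neqAle X1 andbT; apply/eqP => h; apply: nb; constructor 3; split; lra.
  have : 0 <= p - P (x, v).
    apply: (taylor1_max_left _ _ _ (x - x1) _ (taylor1B _ _ _ _ _ T1 T3)); first by lra.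
    move=> t /andP[? ?]; apply: zmax; rewrite /D/= V1 V2; split => //;
        apply/andP; split; lra.
  nra.
have {}Hs : 2 * a * Q (x, v) < v * P (x, v) by apply: Hs; rewrite ?v1v ?vv2.
have a0 : 0 < a by case/andP: Ha => + _; apply: lt_le_trans; rewrite invr_gt0.
have : 2 * a * q <= 2 * a * Q (x, v) by rewrite ler_wpM2l; lra.
lra.
Qed.

(* Kruzhkov's doubling of variables: [w = f (x, v) - f (x, u)] solves
   [w_x = (a / v) w_vv + (a' / u) w_uu] and vanishes on the diagonal, so only the
   concavity of the barrier in [v - u] matters, not the modulus of continuity
   of the coefficients. *)
Lemma doubling_lipschitz {R : realType} (L M x0 : R) (f : R * R -> R) :
  1 < L -> 0 < M ->
  (forall z : R * R, x0 - 1 <= z.1 <= x0 /\ 1/2 <= z.2 <= 3/2 ->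
    solves_at L f z /\ `|f z| <= M) ->
  forall v u, 1/2 <= u -> u <= v -> v <= 3/2 ->
  f (x0, v) - f (x0, u) <= 8 * (1 + 2 * L) * M * (v - u) +
     8 * M * ((v - 1) ^+ 2 + (u - 1) ^+ 2).
Proof.
move=> L1 M0 Hf v0 u0 u0l uv0 v0l.
(* [B] is so large that a single penalty term reaches [2 * M >= w] when [v = 3/2], [u = 1/2] or
   [x = x0 - 1]; on the diagonal [w = 0]. The excess [N - B = 2 * L * B] is the concavity in [v] and
   in [u] that yields the contradiction. *)
pose B := 8 * M; pose N := (1 + 2 * L) * B.
pose Phi (z : R * R * R) := N * (z.1.2 - z.2) * (1 - (z.1.2 - z.2)) +
  B * ((z.1.1 - x0) ^+ 2 + (z.1.2 - 1) ^+ 2 + (z.2 - 1) ^+ 2).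
pose w (z : R * R * R) := f z.1 - f (z.1.1, z.2).
have B0 : 0 < B by rewrite /B; lra.
have N0 : 0 < N by rewrite /N mulr_gt0//; lra.
pose D (z : R * R * R) := x0 - 1 <= z.1.1 <= x0 /\
  [/\ 1/2 <= z.2, z.2 <= z.1.2 & z.1.2 <= 3/2].
suff H z : D z -> w z <= Phi z.
  have /H : D (x0, v0, u0) by split=> //=; lra.
  rewrite /w /Phi /= => H1; apply: (le_trans H1).
  rewrite subrr expr0n add0r lerD2r.
  have : N * (v0 - u0) * (v0 - u0) >= 0 by rewrite -mulrA -expr2 mulr_ge0 ?sqr_ge0// ltW.
  by rewrite /N/B; lra.
move: z => z0 Dz0; rewrite leNgt; apply/negP => fz0.
pose A := (`[x0 - 1, x0] `*` `[1/2, 3/2]) `*` `[1/2, 3/2]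
  `&` [set z : R * R * R | z.2 <= z.1.2].
have AD z : A z -> D z.
  by rewrite /A/D/=/setX/= !in_itv/= => -[[[? /andP[? ?]] /andP[? ?]] ?].
have DA z : D z -> A z.
  by rewrite /A/D/=/setX/= !in_itv/= => -[? [? ? ?]]; split => //;
    split; first split => //; lra.
have c11 (z : R * R * R) : {for z, continuous (fun z : R * R * R => z.1.1)}.
  exact: (continuous_comp (g := fst) cvg_fst cvg_fst).
have c12 (z : R * R * R) : {for z, continuous (fun z : R * R * R => z.1.2)}.
  exact: (continuous_comp (g := snd) cvg_fst cvg_snd).
have c2 (z : R * R * R) : {for z, continuous (fun z : R * R * R => z.2)} by exact: cvg_snd.
have c12B2 (z : R * R * R) :
    {for z, continuous (fun z : R * R * R => z.1.2 - z.2)}.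
  by move: z => z; apply: continuousB; [exact: c12|exact: c2].
have cA : compact A.
  apply: compact_closedI.
    by apply: compact_setX; [apply: compact_setX|]; exact: segment_compact.
  have -> : [set z : R * R * R | z.2 <= z.1.2] =
     (fun z : R * R * R => z.1.2 - z.2) @^-1` [set y | 0 <= y].
    by apply/seteqP; split => z /=; rewrite subr_ge0.
  apply: preimage_closed; last exact: closed_ge.
  move=> z _; exact: c12B2.
have cPhi z : {for z, continuous Phi}.
  have c := @cst_continuous _ R.
  apply: continuousD.
    apply: continuousM; first (apply: continuousM; first exact: c).
      exact: c12B2.
    apply: continuousB; first exact: c.
    exact: c12B2.
  apply: continuousM; first exact: c.
  apply: continuousD; first apply: continuousD.
  - by apply: continuous_sqr; apply: continuousB; [exact: c11|exact: c].
  - by apply: continuous_sqr; apply: continuousB; [exact: c12|exact: c].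
  - by apply: continuous_sqr; apply: continuousB; [exact: c2|exact: c].
have cf : {within A, continuous (fun z => w z - Phi z)}.
  apply: continuous_in_subspaceT => z /set_mem/AD [z1 [z2 z3 z4]].
  apply: continuousB; last exact: cPhi.
  apply: continuousB.
    apply: continuous_comp; first exact: cvg_fst.
    by case: (Hf z.1) => [|[]//]; split => //; lra.
  apply: (continuous_comp (f := fun z : R * R * R => (z.1.1, z.2)) (g := f)).
    exact: (cvg_pair (c11 z) (c2 z)).
  by case: (Hf (z.1.1, z.2)) => [|[]//]; split => //=; lra.
have A0 : A !=set0 by exists z0; exact: DA.
have [z /set_mem/AD Dz zmax] := compact_EVT_max A0 cA cf.
have {}zmax y : D y -> w y - Phi y <= w z - Phi z.
  by move=> /DA/mem_set/zmax.
have fz : Phi z < w z by have := zmax _ Dz0; lra.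
move: z Dz zmax fz => [[x v] u] [/= /andP[X1 X2] [U1 UV V1]] zmax fz.
have [[_ [p [g [q [a [Ha T1 T2 E]]]]]] Mv] := Hf (x, v) ltac:(split => /=; lra).
have [[_ [p' [g' [q' [a' [Ha' T1' T2' E']]]]]] Mu] := Hf (x, u) ltac:(split => /=; lra).
rewrite /= in T1 T2 E T1' T2' E'.
move: Mv Mu; rewrite !ler_norml => /andP[? ?] /andP[? ?].
have w2 : w (x, v, u) <= 2 * M by rewrite /w/=; lra.
have Phi0 : 0 <= N * (v - u) * (1 - (v - u)).
  by rewrite mulr_ge0//; [rewrite mulr_ge0 ?(ltW N0)// subr_ge0|lra].
have sq (y : R) : 0 <= B * y ^+ 2 by rewrite mulr_ge0 ?sqr_ge0// ltW.
have uv : u < v.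
  rewrite lt_neqAle UV andbT; apply/eqP => uv; move: fz; rewrite /w /Phi/= uv.
  have := sq (x - x0); have := sq (v - 1); rewrite !subrr; lra.
have x1 : x0 - 1 < x.
  rewrite lt_neqAle X1 andbT; apply/eqP => h.
  move: fz; rewrite /Phi/= (_ : x - x0 = -1); last by lra.
  have := sq (v - 1); have := sq (u - 1); rewrite /B in Phi0 *; lra.
have u1 : 1/2 < u.
  rewrite lt_neqAle U1 andbT; apply/eqP => h.
  move: fz; rewrite /Phi/= (_ : u - 1 = -(1/2)); last by lra.
  have := sq (v - 1); have := sq (x - x0); rewrite /B in Phi0 *; lra.
have v1 : v < 3/2.
  rewrite lt_neqAle V1 andbT; apply/eqP => h.
  move: fz; rewrite /Phi/= (_ : v - 1 = 1/2); last by lra.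
  have := sq (u - 1); have := sq (x - x0); rewrite /B in Phi0 *; lra.
have qv : q <= B - N.
  rewrite -subr_le0.
  have T3 : taylor2 (fun y => Phi (x, y, u)) v (N * (1 - 2 * (v - u)) + 2 * B * (v - 1)) (B - N).
    by apply: (taylor2_poly _ _ _ _ 0 0) => t; rewrite /Phi/=; ring.
  apply: (taylor2_max _ _ _ _
    (Num.min (v - u) (3/2 - v)) _ (taylor2B _ _ _ _ _ _ _ T2 T3)) => [|t].
    by rewrite lt_min; lra.
  rewrite lt_min !ltr_norml => /andP[/andP[? ?] /andP[? ?]].
  have := zmax (x, v + t, u); rewrite /w/= => H.
  have : D (x, v + t, u) by split=> /=; [rewrite X1 X2|split=> //; lra].
  by move=> /H; lra.
have qu : N - B <= q'.
  rewrite -subr_le0.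
  have T3 : taylor2 (fun y => - Phi (x, v, y)) u (N * (1 - 2 * (v - u)) - 2 * B * (u - 1)) (N - B).
    by apply: (taylor2_poly _ _ _ _ 0 0) => t; rewrite /Phi/=; ring.
  apply: (taylor2_max _ _ _ _
    (Num.min (v - u) (u - 1/2)) _ (taylor2B _ _ _ _ _ _ _ T3 T2')) => [|t].
    by rewrite lt_min; lra.
  rewrite lt_min !ltr_norml => /andP[/andP[? ?] /andP[? ?]].
  have := zmax (x, v, u + t); rewrite /w/= => H.
  have : D (x, v, u + t) by split=> /=; [rewrite X1 X2|split=> //; lra].
  by move=> /H; lra.
(* The maximum may have [x = x0], so only backward steps in [x] are compared. *)
have px : 0 <= p - p' - 2 * B * (x - x0).
  have T3 : taylor1 (fun y => Phi (y, v, u)) x (2 * B * (x - x0)).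
    by apply: (taylor1_poly _ _ _ B) => t; rewrite /Phi/=; ring.
  apply: (taylor1_max_left _ _ _ (x - (x0 - 1)) _
    (taylor1B _ _ _ _ _ (taylor1B _ _ _ _ _ T1 T1') T3)).
    by lra.
  move=> t /andP[? ?].
  have := zmax (x - t, v, u); rewrite /w/= => H.
  have : D (x - t, v, u) by split=> /=; [lra|split=> //; lra].
  by move=> /H; lra.
have La : forall b, L^-1 <= b <= L -> 1 <= b * L.
  by move=> b /andP[+ _]; rewrite -[L^-1]mul1r ler_pdivrMr//; lra.
have NB : B - N = - (2 * (L * B)) by rewrite /N; ring.
(* Used for [(p, q)] and for [(- p', - q')], this gives [p - p' <= - (16/3) * B], whereas [px] and
   [x >= x0 - 1] give [p - p' >= - 2 * B]. *)
have h1 (b r s y : R) : L^-1 <= b <= L -> 0 < y < 3/2 -> y * r = 2 * b * s ->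
    s <= B - N -> 3 * r <= - 8 * B.
  move=> /La Hb /andP[y0 y1] Er; rewrite NB => Hq.
  have b0 : 0 < b by nra.
  have : 2 * b * s <= 2 * b * (- (2 * (L * B))) by rewrite ler_wpM2l//; lra.
  have : B <= b * L * B by rewrite ler_peMl// ltW.
  rewrite -Er => K1 K2.
  have K3 : y * r <= - 4 * B by lra.
  nra.
have := h1 a p q v Ha ltac:(lra) E qv.
have := h1 a' (- p') (- q') u Ha' ltac:(lra) ltac:(lra) ltac:(lra).
nra.
Qed.

(** * Parabolic estimates near [v = 1] *)

Lemma solves_atZ {R : realType} (L c : R) (f : R * R -> R) (z : R * R) :
  solves_at L f z -> solves_at L (fun y => c * f y) z.
Proof.
move=> [fz [p [g [q [a [Ha T1 T2 E]]]]]]; split.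
  by apply: continuousM; [exact: cst_continuous|].
exists (c * p), (c * g), (c * q), a; split => //.
- exact: taylor1Z T1.
- exact: taylor2Z T2.
- by rewrite mulrCA E; ring.
Qed.

(** One of the two points of [doubling_lipschitz] is put at [v = 1]; the surviving penalty
    [8 * M * t ^+ 2] is at most [4 * M] times the size of [t]. Using [f] and [- f] gives both
    signs. *)
Lemma lipschitz_v {R : realType} (L M x0 t : R) (f : R * R -> R) :
  1 < L -> 0 < M ->
  (forall z : R * R, x0 - 1 <= z.1 <= x0 /\ 1/2 <= z.2 <= 3/2 ->
    solves_at L f z /\ `|f z| <= M) ->
  `|t| <= 1/2 -> `|f (x0, 1 + t) - f (x0, 1)| <= 16 * (1 + L) * M * `|t|.
Proof.
move=> L1 M0 Hf t1.
have HN z : x0 - 1 <= z.1 <= x0 /\ 1/2 <= z.2 <= 3/2 ->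
    solves_at L (fun y => -1 * f y) z /\ `|-1 * f z| <= M.
  by move=> /Hf[H1 H2]; split; [exact: solves_atZ|rewrite mulN1r normrN].
have D1 := doubling_lipschitz _ _ _ _ L1 M0 Hf.
have D2 := doubling_lipschitz _ _ _ _ L1 M0 HN.
have Mt : 0 <= M * `|t| by rewrite mulr_ge0// ltW.
have Mt2 : M * t ^+ 2 <= M * `|t| / 2.
  rewrite -normr_id -real_normK ?num_real//.
  rewrite expr2 !normr_id; nra.
have [t0|t0] := leP 0 t.
  rewrite ger0_norm// in t1 Mt Mt2 *.
  have := D1 (1 + t) 1 ltac:(lra) ltac:(lra) ltac:(lra).
  have := D2 (1 + t) 1 ltac:(lra) ltac:(lra) ltac:(lra).
  rewrite [1 + t]addrC addrK subrr => H1 H2.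
  by rewrite ler_norml; apply/andP; split; lra.
rewrite ltr0_norm// in t1 Mt Mt2 *.
have := D1 1 (1 + t) ltac:(lra) ltac:(lra) ltac:(lra).
have := D2 1 (1 + t) ltac:(lra) ltac:(lra) ltac:(lra).
rewrite [1 + t]addrC addrK subrr => H1 H2.
by rewrite ler_norml; apply/andP; split; lra.
Qed.

(** The barrier is a parabola in [v] that rises linearly in [x]. The rate [5 * L] beats diffusion
    because [v >= 1/2] and [a <= L]; the free parameter [e] trades the initial height [K * e]
    against the opening [c = K / e]. *)
Lemma x_increment {R : realType} (L M x0 s e : R) (f : R * R -> R) :
  1 < L -> 0 < M -> 0 <= s -> 0 < e <= 1 ->
  (forall z : R * R, x0 - 1 <= z.1 <= x0 + s /\ 1/2 <= z.2 <= 3/2 ->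
    solves_at L f z /\ `|f z| <= M) ->
  f (x0 + s, 1) - f (x0, 1) <= 16 * (1 + L) * M * (e + 5 * L * s / e).
Proof.
move=> L1 M0 s0 /andP[e0 e1] Hf.
have H1 t : `|t| <= 1/2 -> `|f (x0, 1 + t) - f (x0, 1)| <= 16 * (1 + L) * M * `|t|.
  by apply: lipschitz_v => // z [? ?]; apply: Hf; split => //; lra.
pose K := 16 * (1 + L) * M; pose c := K / e.
have M2K : 32 * M <= K by rewrite /K; nra.
have cK : K <= c by rewrite /c ler_pdivlMr//; nra.
have Ec : K = c * e by rewrite /c divfK// gt_eqF.
have Ks : K * (e + 5 * L * s / e) = K * e + c * (5 * L) * s by rewrite /c; ring.
rewrite -/K in H1 *; rewrite {}Ks.
have c0 : 0 < c by lra.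
clearbody c; clearbody K.
pose Phi (z : R * R) := f (x0, 1) + K * e + c * (z.2 - 1) ^+ 2 + c * (5 * L) * (z.1 - x0).
suff : f (x0 + s, 1) <= Phi (x0 + s, 1).
  rewrite /Phi/= subrr [x0 + s]addrC addrK => H.
  lra.
apply: (comparison L x0 (x0 + s) (1/2) (3/2) f Phi (fun _ => c * (5 * L)) (fun _ => c)).
- lra.
- by move=> z [? ?]; apply: (Hf z _).1; split => //; lra.
- move=> z _; have k := @cst_continuous _ R.
  apply: continuousD; first apply: continuousD; first exact: k.
    apply: continuousM; first exact: k.
    by apply: continuous_sqr; apply: continuousB; [exact: cvg_snd|exact: k].
  apply: continuousM; first exact: k.
  by apply: continuousB; [exact: cvg_fst|exact: k].
- move=> z _; apply: (taylor1_poly _ _ _ 0) => t; rewrite /Phi/=; ring.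
- move=> z _; exists (2 * c * (z.2 - 1)).
  apply: (taylor2_poly _ _ _ _ 0 0) => t; rewrite /Phi/=; ring.
- move=> z a [_ /andP[v1 _]] _ /andP[_ aL].
  have : 0 < c * (5 * L * z.2 - 2 * a) by rewrite mulr_gt0//; nra.
  lra.
- move=> z [z1 z2]; have [|_ Hz2] := Hf z; first by split => //; lra.
  have [|_] := Hf (x0, 1); first by split => /=; lra.
  move: Hz2; rewrite !ler_norml => /andP[? ?] /andP[? ?].
  have x0' : 0 <= c * (5 * L) * (z.1 - x0).
    by rewrite mulr_ge0 ?subr_ge0//; [rewrite mulr_ge0//; lra|case/andP: z1].
  have Ke : 0 <= K * e by rewrite mulr_ge0//; lra.
  have side : (z.2 - 1) ^+ 2 = 1/4 -> f z <= Phi z by rewrite /Phi => ->; lra.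
  case=> [h|h|[h _]|[_ h]]; last by lra.
  + by apply: side; rewrite h; field.
  + by apply: side; rewrite h; field.
  have /H1 : `|z.2 - 1| <= 1/2 by rewrite ler_norml; lra.
  rewrite [1 + _]addrC subrK -h -surjective_pairing ler_norml => /andP[_ Hz].
  rewrite /Phi -real_normK ?num_real// h.
  move: Hz; set T := `|_| => Hz.
  (* As [K = c * e], the Lipschitz bound [K * T] is absorbed by [K * e + c * T ^+ 2]. *)
  have : 0 <= c * (e ^+ 2 - e * T + T ^+ 2) by rewrite mulr_ge0//; nra.
  rewrite Ec in Hz *; rewrite -h; lra.
- by split=> /=; lra.
Qed.

Lemma parabolic_holder {R : realType} (L M s t : R) (f : R * R -> R) :
  1 < L -> 0 < M ->
  (forall z : R * R, -2 <= z.1 <= 1 /\ 1/2 <= z.2 <= 3/2 ->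
    solves_at L f z /\ `|f z| <= M) ->
  `|s| <= 1 -> `|t| <= 1/2 ->
  `|f (s, 1 + t) - f (0, 1)| <=
    16 * (1 + L) * M * (`|t| + (1 + 5 * L) * Num.sqrt `|s|).
Proof.
move=> L1 M0 Hf s1 t1.
(* [e = Num.sqrt (y - x)] balances the two terms of [x_increment]. Keeping [x >= -1] leaves the unit
   of past that the Lipschitz bound consumes. *)
have incr x y : -1 <= x -> x < y -> y <= 1 -> y - x <= 1 ->
    `|f (y, 1) - f (x, 1)| <= 16 * (1 + L) * M * ((1 + 5 * L) * Num.sqrt (y - x)).
  move=> x1 xy y1 yx1.
  have r0 : 0 < Num.sqrt (y - x) by rewrite sqrtr_gt0; lra.
  have r1 : Num.sqrt (y - x) <= 1 by rewrite -sqrtr1 ler_sqrt//; lra.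
  have Hf' z : x - 1 <= z.1 <= x + (y - x) /\ 1/2 <= z.2 <= 3/2 ->
    solves_at L f z /\ `|f z| <= M by move=> [? ?]; apply: Hf; split => //; lra.
  have HN z : x - 1 <= z.1 <= x + (y - x) /\ 1/2 <= z.2 <= 3/2 ->
    solves_at L (fun y => -1 * f y) z /\ `|-1 * f z| <= M.
    by move=> /Hf'[H1 H2]; split; [exact: solves_atZ|rewrite mulN1r normrN].
  have yx0 : 0 <= y - x by lra.
  have e01 : 0 < Num.sqrt (y - x) <= 1 by rewrite r0.
  have := x_increment _ _ _ _ _ _ L1 M0 yx0 e01 Hf'.
  have := x_increment _ _ _ _ _ _ L1 M0 yx0 e01 HN.
  have -> : 5 * L * (y - x) / Num.sqrt (y - x) = 5 * L * Num.sqrt (y - x).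
    move: (sqr_sqrtr yx0) r0; set r := Num.sqrt _ => <- r0.
    by field; rewrite gt_eqF.
  rewrite [x + (y - x)]addrC subrK => H1 H2.
  by rewrite ler_norml; apply/andP; split; lra.
have base : `|f (s, 1) - f (0, 1)| <= 16 * (1 + L) * M * ((1 + 5 * L) * Num.sqrt `|s|).
  have [s0|s0|->] := ltgtP s 0.
  - move: s1; rewrite ltr0_norm// => s1; rewrite distrC.
    by have := incr s 0; rewrite sub0r; apply; lra.
  - move: s1; rewrite gtr0_norm// => s1.
    by have := incr 0 s; rewrite subr0; apply; lra.
  - by rewrite subrr normr0 sqrtr0 !mulr0.
have side : `|f (s, 1 + t) - f (s, 1)| <= 16 * (1 + L) * M * `|t|.
  apply: lipschitz_v => // z [? ?]; apply: Hf; split => //.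
  by move: s1; rewrite ler_norml; lra.
rewrite mulrDr; apply: le_trans (lerD side base).
by have := ler_normD (f (s, 1 + t) - f (s, 1)) (f (s, 1) - f (0, 1)); rewrite addrA subrK.
Qed.

(** * Barriers that spread a gain *)

Lemma taylor1_expR {R : realType} (c x : R) :
  taylor1 (fun y => expR (c * y)) x (c * expR (c * x)).
Proof.
have H : is_derive x 1 (fun y => expR (c * y)) (c * expR (c * x)).
  by apply: is_derive_eq; rewrite /GRing.scale/= mulr1 mulrC.
have [Hd Hv] := H.
have T := derivable_taylor1 _ _ _ Hd; rewrite Hv in T.
move=> e /T[d d0 K]; exists d => // t /K.
by rewrite add0r scale0r add0r /GRing.scale/= mulr1 [t + x]addrC.
Qed.

(** The barrier subtracts from [m] a bump [B] in [v] that decays exponentially in [x]. Near the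
    edges of the strip the bump is convex, so diffusion helps; in the middle it is bounded below and
    the decay rate [k] outweighs diffusion. *)
Lemma spread_in_x {R : realType} (L X m theta e : R) (f : R * R -> R) :
  1 < L -> 0 < theta -> 0 < e <= 1/2 ->
  (forall z : R * R, 0 <= z.1 <= X /\ 1 - e <= z.2 <= 1 + e ->
     solves_at L f z /\ f z <= m) ->
  (forall v, 1 - e <= v <= 1 + e -> f (0, v) <= m - theta) ->
  forall x, 0 <= x <= X ->
    f (x, 1) <= m - theta * expR (- (33 * L / e ^+ 2) * X).
Proof.
move=> L1 th0 /andP[e0 e1] Hf H0 x /andP[x0 xX].
pose i := e ^- 2; have i0 : 0 < i by rewrite invr_gt0 exprn_gt0.
have ie : i * e ^+ 2 = 1 by rewrite mulVf// gt_eqF// exprn_gt0.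
pose k := 33 * L * i.
pose B v := (1 - i * (v - 1) ^+ 2) ^+ 2 : R.
have B0 v : 0 <= B v by exact: sqr_ge0.
pose Phi (z : R * R) := m - theta * B z.2 * expR (- k * z.1).
suff : f (x, 1) <= Phi (x, 1).
  move=> H; apply: (le_trans H); rewrite /Phi /B/= subrr expr0n mulr0 subr0 expr1n mulr1.
  rewrite lerD2l lerN2 ler_pM2l// ler_expR !mulNr lerN2 ler_wpM2l//.
  by rewrite /k !mulr_ge0//; lra.
have k0 : 0 < k by rewrite /k !mulr_gt0//; lra.
have ek v : 1 - e <= v <= 1 + e -> 0 <= 1 - i * (v - 1) ^+ 2 <= 1.
  move=> v1; have : (v - 1) ^+ 2 <= e ^+ 2 by nra.
  move=> H; have := sqr_ge0 (v - 1); rewrite -{2}ie; nra.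
apply: (comparison L 0 X (1 - e) (1 + e) f Phi
  (fun z => 0 - theta * B z.2 * (- k * expR (- k * z.1)))
  (fun z => - (theta * expR (- k * z.1)) *
     (4 * i ^+ 2 * (z.2 - 1) ^+ 2 - 2 * (1 - i * (z.2 - 1) ^+ 2) * i))).
- lra.
- by move=> z /Hf[].
- move=> z _; have c := @cst_continuous _ R.
  apply: continuousB; first exact: c.
  apply: continuousM; first (apply: continuousM; first exact: c).
    apply: continuous_sqr; apply: continuousB; first exact: c.
    apply: continuousM; first exact: c.
    by apply: continuous_sqr; apply: continuousB; [exact: cvg_snd|exact: c].
  apply: continuous_comp; last exact: continuous_expR.
  by apply: continuousM; [exact: c|exact: cvg_fst].
- move=> z _; apply: (taylor1B (fun _ => m)
    (fun y => theta * B z.2 * expR (- k * y)) z.1 0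
    (theta * B z.2 * (- k * expR (- k * z.1)))).
    by apply: (taylor1_poly _ _ _ 0) => t; ring.
  apply: (taylor1Z (fun y => expR (- k * y))); exact: taylor1_expR.
- move=> z _.
  exists (theta * expR (- k * z.1) * (4 * (1 - i * (z.2 - 1) ^+ 2) * i * (z.2 - 1))).
  apply: (taylor2_poly _ _ _ _ (- (theta * expR (- k * z.1)) * (4 * i ^+ 2 * (z.2 - 1)))
    (- (theta * expR (- k * z.1)) * i ^+ 2)) => t; rewrite /Phi/= /B; ring.
- move=> z a [_ /ek] + /andP[v1 _] /andP[aL' aL].
  have a0 : 0 < a by apply: lt_le_trans aL'; rewrite invr_gt0; lra.
  have E0 : 0 < theta * expR (- k * z.1) by rewrite mulr_gt0 ?expR_gt0.
  rewrite /B; set b := 1 - i * (z.2 - 1) ^+ 2.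
  have -> : 4 * i ^+ 2 * (z.2 - 1) ^+ 2 - 2 * b * i = i * (4 - 6 * b) by rewrite /b; ring.
  move=> /andP[b0 b1]; clearbody b.
  rewrite -subr_gt0.
  have -> : z.2 * (0 - theta * b ^+ 2 * (- k * expR (- k * z.1))) -
    2 * a * (- (theta * expR (- k * z.1)) * (i * (4 - 6 * b))) =
    (theta * expR (- k * z.1)) * (i * (33 * L * z.2 * b ^+ 2 + 2 * a * (4 - 6 * b))).
    by rewrite /k; ring.
  rewrite pmulr_rgt0// pmulr_rgt0//.
  have z2 : 1/2 <= z.2 by lra.
  have K1 : 33/2 * L * b ^+ 2 <= 33 * L * z.2 * b ^+ 2.
    rewrite ler_wpM2r ?sqr_ge0//; nra.
  (* Up to the factor [i], [4 - 6 * b] is half the second derivative of [B]. It is positive for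
     [b <= 1/2]; for larger [b] the term with [33 * L] dominates. *)
  have [bs|bs] := leP b (1/2).
    have : 0 <= 33/2 * L * b ^+ 2 by rewrite !mulr_ge0 ?sqr_ge0//; lra.
    have : 0 < a * (4 - 6 * b) by rewrite mulr_gt0//; lra.
    lra.
  have K2 : - (2 * L * `|4 - 6 * b|) <= 2 * a * (4 - 6 * b).
    have := ler_norm (- (4 - 6 * b)); rewrite normrN.
    have := normr_ge0 (4 - 6 * b); nra.
  have : 0 < L * (33/2 * b ^+ 2 - 2 * `|4 - 6 * b|).
    rewrite mulr_gt0//; first by lra.
    by case: (ler0P (4 - 6 * b)) => ?; nra.
  lra.
- move=> z Dz; have [_ fm] := Hf _ Dz; case: Dz => z1 z2.
  have side : i * (z.2 - 1) ^+ 2 = 1 -> f z <= Phi z.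
    by move=> E; rewrite /Phi /B E subrr expr0n mulr0 mul0r subr0.
  case=> [h|h|[h _]|[_ h]]; last by lra.
  + by apply: side; rewrite h -ie; ring.
  + by apply: side; rewrite h -ie; ring.
  have := H0 _ z2; rewrite -h -surjective_pairing => Hz.
  rewrite /Phi h mulr0 expR0 mulr1.
  have : B z.2 <= 1 by rewrite /B expr_le1//; have := ek _ z2; lra.
  by have := B0 z.2; nra.
- by split=> /=; lra.
Qed.

(** A parabola in [v] interpolates between no gain at [v = -1] and the gain [theta] at [v = 1], and
    a term in [x] cancels it at both ends. Over the length [16 * L] that term varies so slowly that
    the second-order term dominates whatever the sign of [v], hence also across [v = 0]. *)
Lemma spread_in_v {R : realType} (L m theta : R) (f : R * R -> R) :
  1 < L -> 0 < theta ->
  (forall z : R * R, 0 <= z.1 <= 16 * L /\ -1 <= z.2 <= 1 ->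
    solves_at L f z /\ f z <= m) ->
  (forall x, 0 <= x <= 16 * L -> f (x, 1) <= m - theta) ->
  forall z : R * R, `|z.1 - 8 * L| <= 1/64 -> `|z.2| <= 1/4 -> f z <= m - theta / 8.
Proof.
move=> L1 th0 Hf H1 z; rewrite !ler_norml => Z1 Z2.
pose j := (8 * L)^-1; have j0 : 0 < j by rewrite invr_gt0; lra.
have jL : j * (8 * L) = 1 by rewrite mulVf// gt_eqF//; lra.
have j1 : j < 1/8 by nra.
pose Phi (z : R * R) := m - theta * ((z.2 + 1) ^+ 2 / 4 - (j * (z.1 - 8 * L)) ^+ 2).
suff H : f z <= Phi z.
  apply: (le_trans H); rewrite /Phi.
  (* The factor 1/8 of the conclusion is [(3/4) ^+ 2 / 4 - 1/64]. *)
  have A1 : 9/16 <= (z.2 + 1) ^+ 2 by nra.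
  have A2 : (j * (z.1 - 8 * L)) ^+ 2 <= 1/64.
    have : - (1/8) <= j * (z.1 - 8 * L) <= 1/8 by apply/andP; split; nra.
    nra.
  nra.
have jx x : 0 <= x <= 16 * L -> -1 <= j * (x - 8 * L) <= 1.
  by move=> /andP[? ?]; apply/andP; split; nra.
apply: (comparison L 0 (16 * L) (-1) 1 f Phi
  (fun z => 2 * theta * j ^+ 2 * (z.1 - 8 * L)) (fun _ => - (theta / 4))).
- lra.
- by move=> y /Hf[].
- move=> y _; have c := @cst_continuous _ R.
  apply: continuousB; first exact: c.
  apply: continuousM; first exact: c.
  apply: continuousB.
    apply: continuousM; last exact: c.
    by apply: continuous_sqr; apply: continuousD; [exact: cvg_snd|exact: c].
  apply: continuous_sqr; apply: continuousM; first exact: c.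
  by apply: continuousB; [exact: cvg_fst|exact: c].
- move=> y _; apply: (taylor1_poly _ _ _ (theta * j ^+ 2)) => t; rewrite /Phi/=; ring.
- move=> y _; exists (- (theta / 2 * (y.2 + 1))).
  by apply: (taylor2_poly _ _ _ _ 0 0) => t; rewrite /Phi/=; field.
- move=> y a [/jx y1 y2] _ /andP[aL _].
  have aj : 8 * j <= a by rewrite /j invfM mulrA mulfV// mul1r.
  have -> : y.2 * (2 * theta * j ^+ 2 * (y.1 - 8 * L)) =
    theta * j * (2 * (y.2 * (j * (y.1 - 8 * L)))) by ring.
  have : -1 <= y.2 * (j * (y.1 - 8 * L)).
    move: y1 y2; set p := j * _ => /andP[? ?] /andP[? ?]; nra.
  have : 0 < theta * j by rewrite mulr_gt0.
  set q := y.2 * _ => tj q1.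
  have : theta * (8 * j) <= theta * a by rewrite ler_wpM2l// ltW.
  have : theta * j * (-2) <= theta * j * (2 * q) by rewrite ler_wpM2l//; lra.
  lra.
- move=> y Dy; have [_ fm] := Hf _ Dy; case: Dy => y1 y2.
  have sq := sqr_ge0 (j * (y.1 - 8 * L)).
  have side : (j * (y.1 - 8 * L)) ^+ 2 = 1 -> f y <= Phi y.
    move=> E; rewrite /Phi E; have : (y.2 + 1) ^+ 2 <= 4 by nra.
    by nra.
  case=> h.
  + by rewrite /Phi h addNr expr0n mul0r; nra.
  + have := H1 _ y1; rewrite -h -surjective_pairing => H.
    rewrite /Phi h; nra.
  + by apply: side; case: h => -> _; rewrite sub0r mulrN jL sqrrN expr1n.
  + apply: side; case: h => -> _.
    have -> : 16 * L - 8 * L = 8 * L by ring.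
    by rewrite jL expr1n.
- by split=> /=; lra.
Qed.

(** * Invariance of the equation *)

Lemma taylor1_affine {R : realType} (h : R -> R) (b r x p : R) :
  taylor1 h (b + r * x) p -> taylor1 (fun y => h (b + r * y)) x (r * p).
Proof.
move=> th e e0; have r0 : 0 < `|r| + 1 by rewrite ltr_pwDr.
have [d d0 H] := th _ (divr_gt0 e0 r0).
exists (d / (`|r| + 1)); first exact: divr_gt0.
move=> t; rewrite ltr_pdivlMr// => td.
have rt : `|r * t| <= `|t| * (`|r| + 1).
  by rewrite normrM mulrC ler_wpM2l// lerDl.
have -> : h (b + r * (x + t)) - h (b + r * x) - r * p * t =
  h (b + r * x + r * t) - h (b + r * x) - p * (r * t).
  by rewrite mulrDr addrA; ring.
apply: (le_trans (H _ (le_lt_trans rt td))).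
apply: (le_trans (y := e / (`|r| + 1) * (`|t| * (`|r| + 1)))).
  by rewrite ler_wpM2l// ltW// divr_gt0.
by rewrite mulrCA divfK ?gt_eqF// mulrC.
Qed.

Lemma taylor2_dilation {R : realType} (h : R -> R) (r x g q : R) :
  taylor2 h (r * x) g q -> taylor2 (fun y => h (r * y)) x (r * g) (r ^+ 2 * q).
Proof.
move=> th e e0; have r0 : 0 < `|r| + 1 by rewrite ltr_pwDr.
have r20 : 0 < r ^+ 2 + 1 by rewrite ltr_pwDr// sqr_ge0.
have [d d0 H] := th _ (divr_gt0 e0 r20).
exists (d / (`|r| + 1)); first exact: divr_gt0.
move=> t; rewrite ltr_pdivlMr// => td.
have rt : `|r * t| <= `|t| * (`|r| + 1).
  by rewrite normrM mulrC ler_wpM2l// lerDl.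
have -> : h (r * (x + t)) - h (r * x) - r * g * t - r ^+ 2 * q * t ^+ 2 =
  h (r * x + r * t) - h (r * x) - g * (r * t) - q * (r * t) ^+ 2.
  by rewrite mulrDr; ring.
apply: (le_trans (H _ (le_lt_trans rt td))).
rewrite exprMn mulrA ler_wpM2r ?sqr_ge0// mulrAC ler_pdivrMr// ler_pM2l//.
by rewrite lerDl.
Qed.

(** The kinetic scaling: both sides of the equation pick up the factor [r ^+ 2]. A negative [r]
    reverses both variables and so brings negative velocities to positive ones. *)
Definition dilation {R : realType} (x0 r : R) (z : R * R) : R * R :=
  (x0 + r ^+ 3 * z.1, r * z.2).

Lemma solves_at_dilation {R : realType} (L x0 r : R) (f : R * R -> R) (z : R * R) :
  r != 0 -> solves_at L f (dilation x0 r z) -> solves_at L (f \o dilation x0 r) z.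
Proof.
move=> r0 [fz [p [g [q [a [Ha T1 T2 E]]]]]]; split.
  apply: continuous_comp; last exact: fz.
  have c1 : {for z, continuous (fun z : R * R => x0 + r ^+ 3 * z.1)}.
    apply: continuousD; first exact: cst_continuous.
    by apply: continuousM; [exact: cst_continuous|exact: cvg_fst].
  have c2 : {for z, continuous (fun z : R * R => r * z.2)}.
    by apply: continuousM; [exact: cst_continuous|exact: cvg_snd].
  exact: (cvg_pair c1 c2).
exists (r ^+ 3 * p), (r * g), (r ^+ 2 * q), a; split => //.
- exact: taylor1_affine T1.
- exact: taylor2_dilation T2.
- rewrite /= in E; transitivity (r ^+ 2 * (r * z.2 * p)); first by ring.
  by rewrite E; ring.
Qed.

Lemma solves_at_affine {R : realType} (L c b : R) (f : R * R -> R) (z : R * R) :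
  solves_at L f z -> solves_at L (fun y => c * f y - b) z.
Proof.
move=> /(solves_atZ _ c)[fz [p [g [q [a [Ha T1 T2 E]]]]]]; split.
  by apply: continuousB; [exact: fz|exact: cst_continuous].
exists (p - 0), (g - 0), (q - 0), a; rewrite !subr0; split => //.
- rewrite -[p]subr0; apply: (taylor1B _ (fun _ => b) _ _ _ T1).
  by apply: (taylor1_poly _ _ _ 0) => t; ring.
- rewrite -[g]subr0 -[q]subr0; apply: (taylor2B _ (fun _ => b) _ _ _ _ _ T2).
  by apply: (taylor2_poly _ _ _ _ 0 0) => t; ring.
Qed.

(** * Oscillation decay at the degenerate line *)

Lemma unit_growth {R : realType} (L : R) : 1 < L ->
  exists2 c : R, 0 < c < 1 & forall f : R * R -> R,
    (forall z : R * R, -1 <= z.1 <= 16 * L /\ -1 <= z.2 <= 3/2 ->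
       solves_at L f z /\ `|f z| <= 1) ->
    f (0, 1) <= 0 ->
    forall z : R * R, `|z.1 - 8 * L| <= 1/64 -> `|z.2| <= 1/4 -> f z <= 1 - c.
Proof.
(* [16 * (1 + L)] is the constant of [lipschitz_v] for [M = 1], so [f] rises by at most 1/2 over a
   distance [e]. *)
move=> L1; pose e := (2 * (16 * (1 + L)))^-1 : R.
have K0 : 0 < 2 * (16 * (1 + L)) by lra.
have e0 : 0 < e by rewrite invr_gt0.
have eK : e * (2 * (16 * (1 + L))) = 1 by rewrite mulVf// gt_eqF.
have e1 : e <= 1/2 by nra.
pose E := expR (- (33 * L / e ^+ 2) * (16 * L)).
have E0 : 0 < E by exact: expR_gt0.
have E1 : E <= 1.
  rewrite -expR0 ler_expR mulNr oppr_le0 !mulr_ge0 ?invr_ge0 ?exprn_ge0//; lra.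
(* Gain 1/2 on the initial segment, factor [E] along [v = 1], factor 1/8 across [v = 0]. *)
exists (E / 16); first by lra.
move=> f Hf f01 z z1 z2.
have -> : 1 - E / 16 = 1 - (1/2 * E) / 8 by field.
have th0 : 0 < 1/2 * E by lra.
have h0 : 0 < 1/2 :> R by lra.
apply: (spread_in_v L 1 (1/2 * E) f) => //.
  move=> y [y1 y2]; have [|H1 H2] := Hf y; first by split; lra.
  by split=> //; apply: le_trans (ler_norm _) H2.
apply: (spread_in_x L (16 * L) 1 (1/2) e) => //.
- by rewrite e0.
- move=> y [y1 y2]; have [|H1 H2] := Hf y; first by split; lra.
  by split=> //; apply: le_trans (ler_norm _) H2.
move=> v ve.
have ve' : `|v - 1| <= e by rewrite ler_norml; lra.
have : `|f (0, 1 + (v - 1)) - f (0, 1)| <= 16 * (1 + L) * 1 * `|v - 1|.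
  apply: lipschitz_v => //; last exact: le_trans ve' e1.
  by move=> y [y1 y2]; apply: Hf; split; lra.
rewrite [1 + _]addrC subrK ler_norml => /andP[_ H].
have : 16 * (1 + L) * `|v - 1| <= 16 * (1 + L) * e by rewrite ler_wpM2l//; lra.
lra.
Qed.

(** The values are rescaled from [[m, m + w]] to [[-1, 1]]. Either the rescaled function or its
    opposite is nonpositive at [(0, 1)], and [unit_growth] lowers the maximum or raises the minimum.
    Halving [c] undoes the rescaling by [2 / w]. *)
Lemma oscillation_step {R : realType} (L : R) : 1 < L ->
  exists2 c : R, 0 < c < 1 & forall (f : R * R -> R) (m w : R), 0 < w ->
    (forall z : R * R, -1 <= z.1 <= 16 * L /\ -1 <= z.2 <= 3/2 ->
       solves_at L f z /\ m <= f z <= m + w) ->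
    exists m', forall z : R * R, `|z.1 - 8 * L| <= 1/64 -> `|z.2| <= 1/4 ->
       m' <= f z <= m' + (1 - c) * w.
Proof.
move=> L1; have [c c01 Hc] := unit_growth L L1.
exists (c / 2); first by lra.
move=> f m w w0 Hf.
have w2 : 2 / w * w = 2 by rewrite divfK// gt_eqF.
have w20 : 0 < 2 / w by rewrite divr_gt0.
have rng (z : R * R) : -1 <= z.1 <= 16 * L /\ -1 <= z.2 <= 3/2 ->
    -1 <= 2 / w * (f z - m) - 1 <= 1.
  by move=> /Hf[_ /andP[? ?]]; apply/andP; split; nra.
have tgt (z : R * R) : `|z.1 - 8 * L| <= 1/64 -> `|z.2| <= 1/4 ->
   -1 <= z.1 <= 16 * L /\ -1 <= z.2 <= 3/2.
  by rewrite !ler_norml => ? ?; split; lra.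
have [f0|f0] := leP (2 / w * (f (0, 1) - m) - 1) 0.
  exists m => z z1 z2; have [_ /andP[-> _]] := Hf _ (tgt _ z1 z2).
  have : 2 / w * f z - (2 / w * m + 1) <= 1 - c.
    apply: (Hc (fun y => 2 / w * f y - (2 / w * m + 1))) => //; last by lra.
    move=> y Dy; split; first by apply: solves_at_affine; case: (Hf _ Dy).
    by have := rng _ Dy; rewrite ler_norml; lra.
  by move=> /= H; nra.
exists (m + c / 2 * w) => z z1 z2; have [_ /andP[_ fz]] := Hf _ (tgt _ z1 z2).
have : - (2 / w) * f z - - (2 / w * m + 1) <= 1 - c.
  apply: (Hc (fun y => - (2 / w) * f y - - (2 / w * m + 1))) => //; last by lra.
  move=> y Dy; split; first by apply: solves_at_affine; case: (Hf _ Dy).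
  by have := rng _ Dy; rewrite ler_norml; lra.
by move=> H; apply/andP; split; nra.
Qed.

(** Induction on the scale. The dilation is based at [x0 - 8 * L * r ^+ 3], so that the region where
    [oscillation_step] reduces the oscillation is centred at [(x0, 0)]. *)
Lemma oscillation_decay {R : realType} (L : R) : 1 < L ->
  exists eta c : R, [/\ 0 < eta < 1, 0 < c < 1 &
    forall (f : R * R -> R) (M x0 : R), 0 < M ->
    (forall z : R * R, `|z.1 - x0| < 1 /\ `|z.2| < 1 -> solves_at L f z /\ `|f z| <= M) ->
    forall n : nat, exists m, forall z,
      `|z.1 - x0| < (eta ^+ n) ^+ 3 -> `|z.2| < eta ^+ n ->
      m <= f z <= m + (1 - c) ^+ n * (2 * M)].
Proof.
move=> L1; have [c c01 Hc] := oscillation_step L L1.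
(* With [r = rho * k] the dilated rectangle of [oscillation_step] fits in the cylinder of radius
   [rho]: [3/2 * k < 1] and [9 * L * k ^+ 3 = 3 * k ^+ 2 < 1]. The ratio is [k / 4] because the
   reduced region has half-sides [1/4] in [v] and [1/64 = (1/4) ^+ 3] in [x]. *)
pose k := (3 * L)^-1 : R; have k0 : 0 < k by rewrite invr_gt0; lra.
have kL : k * (3 * L) = 1 by rewrite mulVf// gt_eqF//; lra.
have k1 : k < 1/3 by nra.
exists (k / 4), c; split => //; first by lra.
move=> f M x0 M0 Hf; elim=> [|n [m IH]].
  exists (- M) => z; rewrite !expr0 expr1n => z1 z2.
  by have [//|_] := Hf z; rewrite ler_norml mul1r => /andP[-> ?]; lra.
pose rho := (k / 4) ^+ n.
have rho0 : 0 < rho by rewrite exprn_gt0//; lra.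
have rho1 : rho <= 1 by rewrite exprn_ile1//; lra.
pose r := rho * k; have r0 : 0 < r by rewrite mulr_gt0.
have r30 : 0 < r ^+ 3 by rewrite exprn_gt0.
have rneq0 : r != 0 by rewrite gt_eqF.
pose x1 := x0 - 8 * L * r ^+ 3.
have W0 : 0 < (1 - c) ^+ n * (2 * M) by rewrite mulr_gt0 ?exprn_gt0//; lra.
have rho31 : rho ^+ 3 <= 1 by rewrite exprn_ile1// ltW.
have rho30 : 0 < rho ^+ 3 by exact: exprn_gt0.
have small : 9 * L * r ^+ 3 < rho ^+ 3.
  rewrite /r exprMn mulrCA -[ltRHS]mulr1 (ltr_pM2l rho30).
  have -> : 9 * L * k ^+ 3 = 3 * k ^+ 2 * (k * (3 * L)) by ring.
  by rewrite kL; nra.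
have [z [/= z1 z2]|m' Hm] := Hc (f \o dilation x1 r) m _ W0.
  have y1 : `|(dilation x1 r z).1 - x0| < rho ^+ 3.
    rewrite /dilation/x1/=.
    have -> : x0 - 8 * L * r ^+ 3 + r ^+ 3 * z.1 - x0 = (z.1 - 8 * L) * r ^+ 3 by ring.
    rewrite normrM (gtr0_norm r30); apply: le_lt_trans small.
    rewrite ler_wpM2r//; first by rewrite ltW.
    by rewrite ler_norml; lra.
  have y2 : `|(dilation x1 r z).2| < rho.
    rewrite /dilation/= normrM (gtr0_norm r0).
    have z2' : `|z.2| <= 3/2 by rewrite ler_norml; lra.
    have : r * `|z.2| <= r * (3/2) by rewrite ler_wpM2l// ltW.
    rewrite /r; nra.
  split; last exact: IH.
  apply: solves_at_dilation => //; apply: (Hf _ _).1; split; lra.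
have Er : k / 4 * rho = r / 4 by rewrite /r; field.
exists m' => y; rewrite (exprS (k / 4)) -/rho Er => y1 y2.
pose z : R * R := ((y.1 - x0) / r ^+ 3 + 8 * L, y.2 / r).
have -> : y = dilation x1 r z.
  rewrite /dilation/z/x1/=; apply: injective_projections => /=; field => //.
rewrite exprS -mulrA; apply: Hm; rewrite /z/=.
  rewrite addrK normrM normfV (gtr0_norm r30) ler_pdivrMr//.
  apply: (le_trans (ltW y1)); rewrite exprMn mulrC.
  by rewrite ler_pM2r//; lra.
by rewrite normrM normfV (gtr0_norm r0) ler_pdivrMr// mulrC; lra.
Qed.

(** * Hölder bounds from oscillation decay *)

Lemma geometric_bracket {R : realType} (eta rho : R) :
  0 < eta < 1 -> 0 < rho <= 1 -> exists n, eta ^+ n.+1 <= rho <= eta ^+ n.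
Proof.
move=> /andP[eta0 eta1] /andP[rho0 rho1].
have ex : exists n, eta ^+ n.+1 <= rho.
  have : eta ^+ n @[n --> \oo] --> 0 by apply: cvg_expr; rewrite gtr0_norm.
  move=> /cvgrPdist_le /(_ _ rho0) [n _ Hn]; exists n.
  have := Hn n.+1 (leqnSn n); rewrite sub0r normrN ger0_norm//.
  by rewrite exprn_ge0// ltW.
case: (ex_minnP ex) => -[|n] Hn Hmin; first by exists 0%N; rewrite Hn expr0.
exists n.+1; rewrite Hn/= leNgt; apply/negP => /ltW/Hmin.
by rewrite ltnn.
Qed.

Lemma oscillation_holder {R : realType} (L : R) : 1 < L ->
  exists alpha C : R, [/\ 0 < alpha, 0 < C &
    forall (f : R * R -> R) (M x0 rho : R), 0 < M -> 0 < rho <= 1 ->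
    (forall z : R * R, `|z.1 - x0| < 1 /\ `|z.2| < 1 -> solves_at L f z /\ `|f z| <= M) ->
    forall z z' : R * R, `|z.1 - x0| < rho ^+ 3 -> `|z.2| < rho ->
      `|z'.1 - x0| < rho ^+ 3 -> `|z'.2| < rho ->
      `|f z - f z'| <= C * M * rho `^ alpha].
Proof.
move=> L1; have [eta [c [eta01 c01 H]]] := oscillation_decay L L1.
have [eta0 eta1] := andP eta01; have [c0 c1] := andP c01.
have c1' : 0 < 1 - c by lra.
have lneta : ln eta < 0 by apply: ln_lt0; rewrite eta0.
have lnc : ln (1 - c) < 0 by apply: ln_lt0; lra.
(* This exponent converts a factor [1 - c] per scale [eta] into a power of the radius; the constant
   [2 / (1 - c)] pays for rounding [rho] to a power of [eta]. *)
pose alpha := ln (1 - c) / ln eta.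
have alpha0 : 0 < alpha by rewrite nmulr_lgt0// invr_lt0.
have pe : eta `^ alpha = 1 - c.
  by rewrite /powR gt_eqF// /alpha divfK ?lt_eqF// lnK.
have C0 : 0 < 2 / (1 - c) by rewrite divr_gt0.
exists alpha, (2 / (1 - c)); split => //.
move=> f M x0 rho M0 rho01 Hf z z' z1 z2 z'1 z'2.
have [n /andP[n1 n2]] := geometric_bracket _ _ eta01 rho01.
have rho0 : 0 < rho by case/andP: rho01.
have n3 : rho ^+ 3 <= (eta ^+ n) ^+ 3.
  by rewrite lerXn2r// nnegrE ltW// exprn_gt0.
have [m Hm] := H f M x0 M0 Hf n.
have /andP[? ?] := Hm z (lt_le_trans z1 n3) (lt_le_trans z2 n2).
have /andP[? ?] := Hm z' (lt_le_trans z'1 n3) (lt_le_trans z'2 n2).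
apply: (le_trans (y := (1 - c) ^+ n * (2 * M))); first by rewrite ler_norml; lra.
have : (1 - c) ^+ n.+1 <= rho `^ alpha.
  have -> : (1 - c) ^+ n.+1 = (eta ^+ n.+1) `^ alpha.
    by rewrite -pe -(powR_mulrn _ (powR_ge0 eta alpha)) -(powR_mulrn _ (ltW eta0)) powRAC.
  by apply: ge0_ler_powR => //; rewrite ?nnegrE ?exprn_ge0// ltW.
rewrite exprS => Hp.
have -> : (1 - c) ^+ n * (2 * M) = 2 / (1 - c) * M * ((1 - c) * (1 - c) ^+ n).
  by field; rewrite gt_eqF.
by rewrite ler_wpM2l// ltW// mulr_gt0.
Qed.

(** For [h >= 1/3] the bound by [M] is enough. If the velocity of [z] is at most [h] in size, both
    points lie in a cylinder of radius [3 * h] centred on [v = 0]. Otherwise dilation by that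
    velocity puts [z] at [(0, 1)], and the power 6 leaves distances at most [h ^+ 3] in [x] and
    [h ^+ 5] in [v]. *)
Lemma interior_holder {R : realType} (L : R) : 1 < L ->
  exists alpha C : R, [/\ 0 < alpha, alpha <= 1, 0 < C &
    forall (f : R * R -> R) (M h : R), 0 < M -> 0 < h ->
    (forall z, cyl 2 z -> solves_at L f z /\ `|f z| <= M) ->
    forall z z' : R * R, cyl 1 z -> cyl 1 z' ->
      `|z'.1 - z.1| <= h ^+ 6 -> `|z'.2 - z.2| <= h ^+ 6 ->
      `|f z' - f z| <= C * M * h `^ alpha].
Proof.
move=> L1; have [alpha0 [C0 [alpha00 C00 HO]]] := oscillation_holder L L1.
(* The cap at 1 yields [h <= P] for [h <= 1] and a factor at most 3 from the radius [3 * h]. *)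
pose alpha := Num.min alpha0 1.
have al0 : 0 < alpha by rewrite lt_min alpha00 ltr01.
have al1 : alpha <= 1 by rewrite ge_min lexx orbT.
have al2 : alpha <= alpha0 by rewrite ge_min lexx.
pose K := 16 * (1 + L) * (2 + 5 * L).
have K0 : 0 < K by rewrite /K !mulr_gt0//; lra.
exists alpha, (6 + 3 * C0 + K); split; [by []|by []|by lra|].
move=> f M h M0 h0 Hf z z' [z1 z2] [z'1 z'2] d1 d2.
rewrite expr1n in z1 z'1.
have P0 := powR_ge0 h alpha; set P := h `^ alpha in P0 *.
suff : `|f z' - f z| <= 6 * M * P \/ `|f z' - f z| <= C0 * M * (3 * P) \/
    `|f z' - f z| <= K * M * P.
  have A1 : 0 <= M * P by rewrite mulr_ge0// ltW.
  have A2 : 0 <= C0 * (M * P) by rewrite mulr_ge0// ltW.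
  have A3 : 0 <= K * (M * P) by rewrite mulr_ge0// ltW.
  by move=> [|[|]] B; apply: (le_trans B); lra.
have cylP (y : R * R) : `|y.1| < 8 -> `|y.2| < 2 -> cyl 2 y.
  by move=> y1 y2; split => //; apply: (lt_le_trans y1); lra.
have [h3|h3] := leP (1/3) h.
  left; have Ph : 1/3 <= P.
    have [h1|/ltW h1] := leP h 1.
      apply: (le_trans h3); apply: ger1_powR => //.
      by rewrite h0.
    apply: (le_trans (y := 1)); first by lra.
    by rewrite -(powRr0 h); apply: ler_powR => //; exact: ltW.
  have [|_] := Hf z; first by apply: cylP; lra.
  have [|_] := Hf z'; first by apply: cylP; lra.
  rewrite !ler_norml => /andP[? ?] /andP[? ?].
  by apply/andP; split; nra.
have h1 : h <= 1 by lra.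
have hn n : 0 < h ^+ n by rewrite exprn_gt0.
have hn1 n : h ^+ n <= 1 by rewrite exprn_ile1// ltW.
have hP : h <= P.
  by apply: ger1_powR => //; rewrite h0.
have [vh|vh] := leP `|z.2| h.
  right; left.
  have h31 : 0 < 3 * h <= 1 by lra.
  have H3P : (3 * h) `^ alpha0 <= 3 * P.
    apply: (le_trans (y := (3 * h) `^ alpha)).
      exact: ger_powR.
    rewrite (powRM _ (ler0n _ 3) (ltW h0)) ler_wpM2r//.
    by apply: ler1_powR => //; lra.
  have h6 : h ^+ 6 <= h ^+ 3.
    by rewrite (exprD h 3 3) ler_piMr// ltW.
  have h6' : h ^+ 6 <= h by rewrite exprS ler_piMr// ltW.
  have h33 : h ^+ 3 < (3 * h) ^+ 3 by rewrite exprMn; have := hn 3; lra.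
  apply: (le_trans (y := C0 * M * (3 * h) `^ alpha0)); last first.
    by rewrite ler_wpM2l// ltW// mulr_gt0.
  apply: (HO f M z.1) => //.
  - move=> y [y1 y2]; apply: Hf; apply: cylP; last by lra.
    have := ler_normD (y.1 - z.1) z.1; rewrite subrK; lra.
  - by apply: (le_lt_trans d1); lra.
  - have := ler_normD (z'.2 - z.2) z.2; rewrite subrK; lra.
  - by rewrite subrr normr0 exprn_gt0//; lra.
  - by lra.
right; right.
have v0 : z.2 != 0 by rewrite -normr_gt0; lra.
pose s := (z'.1 - z.1) / z.2 ^+ 3; pose t := (z'.2 - z.2) / z.2.
have v0' : 0 < `|z.2| by lra.
have vn n : h ^+ n <= `|z.2| ^+ n by apply: lerXn2r; rewrite ?nnegrE ltW.
have sh : `|s| <= h ^+ 3.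
  rewrite normrM normfV normrX ler_pdivrMr ?exprn_gt0//.
  by apply: (le_trans d1); rewrite (exprD h 3 3) ler_wpM2l// ltW.
have th : `|t| <= h ^+ 5.
  rewrite normrM normfV ler_pdivrMr//.
  by apply: (le_trans d2); rewrite (exprD h 5 1) expr1 ler_wpM2l// ltW.
have h5 : h ^+ 5 <= h by rewrite exprS ler_piMr// ltW.
have s1 : `|s| <= 1 by apply: (le_trans sh).
have t1 : `|t| <= 1/2 by lra.
(* Since [h ^+ 3 <= h ^+ 2], the square-root modulus in [x] still gives a full power of [h]. *)
have sq : Num.sqrt `|s| <= h.
  rewrite -[leRHS](ger0_norm (ltW h0)) -(sqrtr_sqr h); apply: ler_wsqrtr.
  by apply: (le_trans sh); rewrite exprSr ler_piMr ?sqr_ge0.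
have Hg y : -2 <= y.1 <= 1 /\ 1/2 <= y.2 <= 3/2 ->
    solves_at L (f \o dilation z.1 z.2) y /\ `|(f \o dilation z.1 z.2) y| <= M.
  move=> [y1 y2].
  have : cyl 2 (dilation z.1 z.2 y).
    apply: cylP; rewrite /dilation/=.
      apply: (le_lt_trans (ler_normD _ _)); rewrite normrM normrX.
      have : `|z.2| ^+ 3 <= 1 by rewrite exprn_ile1// ltW.
      have : 0 <= `|z.2| ^+ 3 by rewrite exprn_ge0.
      have : `|y.1| <= 2 by rewrite ler_norml; lra.
      nra.
    by rewrite normrM [`|y.2|]ger0_norm; nra.
  by move=> /Hf[H1 H2]; split => //; exact: solves_at_dilation.
have := parabolic_holder _ _ _ _ _ L1 M0 Hg s1 t1.
have -> : (f \o dilation z.1 z.2) (s, 1 + t) = f z'.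
  congr f; rewrite /dilation/s/t/=.
  by apply: injective_projections => /=; field.
have -> : (f \o dilation z.1 z.2) (0, 1) = f z.
  congr f; rewrite /dilation/= mulr0 addr0 mulr1.
  by rewrite -surjective_pairing.
move=> H; apply: (le_trans H).
have K1 : 0 <= 16 * (1 + L) * M.
  by rewrite mulr_ge0 ?(ltW M0)// mulr_ge0// addr_ge0//; lra.
have -> : K * M * P = 16 * (1 + L) * M * (P + (1 + 5 * L) * P) by rewrite /K; ring.
rewrite ler_wpM2l// lerD//; first by lra.
by rewrite ler_wpM2l//; lra.
Qed.

(** * Essential supremum and conclusion *)

(** By continuity, a violation at [z] would persist on a ball, which is a product of intervals and
    has positive measure. The maximum principle needs this pointwise form of the bound. *)
Lemma norm_le_Linfty_norm {R : realType} (r : R) (f : R * R -> R) (z : R * R) :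
  cyl r z -> {for z, continuous f} -> (`|f z|%:E <= Linfty_norm (cyl r) f)%E.
Proof.
move=> Uz fz; rewrite leNgt; apply/negP.
pose mu := ((@lebesgue_measure R) \x (@lebesgue_measure R))%E.
have mball (x e : R) : measurable (ball x e : set R).
  by rewrite ball_itv; exact: measurable_itv.
have mub (y : R * R) (e : R) : 0 < e -> (0 < mu (ball y e))%E.
  move=> e0.
  have -> : ball y e = ball y.1 e `*` ball y.2 e by [].
  have lb (x : R) : (0 < lebesgue_measure (ball x e))%E.
    by rewrite lebesgue_measure_ball ?ltW// lte_fin pmulrn_lgt0.
  rewrite /mu product_measure1E; [|exact: mball..].
  by apply: mule_gt0; exact: lb.
have bm (y : R * R) (e : R) : measurable (ball y e).
  have -> : ball y e = ball y.1 e `*` ball y.2 e by [].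
  by apply: measurableX; exact: mball.
(* The norm of infinite order unfolds to an essential supremum only when the whole space has
   positive measure. *)
have muT : (0 < mu setT)%E.
  by apply: (lt_le_trans (mub z 1 ltr01)); apply: le_measure => //;
    rewrite ?inE; [exact: bm|exact: measurableT].
rewrite /Linfty_norm unlock muT.
set g := (abse \o _); set N := ess_sup _ _.
have N0 : (0 <= N)%E.
  by apply: ess_sup_gee => //; apply: nearW => x; exact: abse_ge0.
have := ess_sup_ge mu g; rewrite -/N.
move: N0; case: N => [n|//|//] n0 [A [mA A0 sA]]; rewrite lte_fin => nf.
have : \forall y \near z, cyl r y /\ n < `|f y|.
  near=> y; split; near: y; first exact: cyl_nbhs.
  have cf : {for z, continuous (fun y => `|f y|)}.
    by apply: continuous_comp; [exact: fz|exact: norm_continuous].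
  exact: (cvgr_gt _ cf).
move=> /nbhs_ballP[e /= e0 He].
suff : (mu (ball z e) <= mu A)%E.
  have -> : mu A = 0%E by exact: A0.
  by rewrite leNgt mub.
apply: le_measure; rewrite ?inE; [exact: bm|exact: mA|].
move=> y /He[Uy ny]; apply: sA => /=.
rewrite /g/= patchE mem_set// lee_fin; apply/negP; rewrite -ltNge//.
Unshelve. all: by end_near. Qed.

Lemma norm_le_euclid {R : realType} (z : R * R) :
  `|z.1| <= euclid z /\ `|z.2| <= euclid z.
Proof.
by rewrite /euclid -!sqrtr_sqr; split; apply: ler_wsqrtr;
  rewrite ?lerDl ?lerDr sqr_ge0.
Qed.

Theorem theorem1p1 (R : realType) (Lambda : R) (hLambda : 1 < Lambda) :
  exists alpha C : R,
    [/\ 0 < alpha, alpha < 1, 1 < C &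
      forall a f : R * R -> R,
        (forall z, cyl 2 z -> Lambda^-1 <= a z <= Lambda) ->
        classical_solution (cyl 2) a f ->
        (holder_norm alpha (cyl 1) f <= C%:E * Linfty_norm (cyl 2) f)%E].
Proof.
have [alpha [C [al0 al1 C0 H]]] := interior_holder Lambda hLambda.
(* The scale [h] will satisfy [h ^+ 6 = d], whence the exponent. In [2 + C] the 2 covers the
   supremum and [C] the seminorm. *)
exists (alpha / 6), (2 + C); split; [lra|lra|lra|move=> a f Ha Hf].
have fbound z : cyl 2 z -> (`|f z|%:E <= Linfty_norm (cyl 2) f)%E.
  by move=> Uz; apply: norm_le_Linfty_norm => //; case: Hf => + _ _ _ _; exact.
have sub12 (z : R * R) : cyl 1 z -> cyl 2 z.
  by move=> [z1 z2]; rewrite expr1n in z1; split; lra.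
have origin : cyl 2 (0 : R * R) by split; rewrite /= normr0; lra.
have := le_trans (_ : 0 <= `|f 0|%:E)%E (fbound _ origin).
rewrite lee_fin => /(_ (normr_ge0 _)) N0.
case EN : (Linfty_norm (cyl 2) f) => [N| |]; rewrite EN in N0 fbound; last by [].
- rewrite lee_fin in N0.
  have {}fbound z : cyl 2 z -> `|f z| <= N by move=> /fbound; rewrite lee_fin.
  rewrite -EFinM mulrDl EFinD; apply: leeD.
    apply: ge_ereal_sup => _ [z /sub12/fbound fz <-]; rewrite lee_fin; lra.
  apply: ge_ereal_sup => _ [[z z'] /= [Uz Uz' zz'] <-]; rewrite lee_fin.
  set d := euclid (z - z').
  have d0 : 0 < d.
    rewrite sqrtr_gt0 lt_neqAle addr_ge0 ?sqr_ge0// andbT eq_sym.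
    rewrite paddr_eq0 ?sqr_ge0// !sqrf_eq0; apply: contra zz' => /andP[/eqP e1 /eqP e2].
    by rewrite -subr_eq0; apply/eqP; exact: injective_projections.
  pose h := d `^ (6^-1).
  have h6 : h ^+ 6 = d.
    by rewrite -powR_mulrn ?powR_ge0// -powRrM mulVf ?powRr1 ?ltW.
  have [d1 d2] := norm_le_euclid (z - z').
  rewrite ler_pdivrMr ?powR_gt0// mulrC [alpha / 6]mulrC powRrM -/h.
  apply/ler_addgt0Pr => e e0.
  have P0 : 0 <= h `^ alpha by exact: powR_ge0.
  have Pe : 0 < C * (h `^ alpha) + 1 by rewrite ltr_wpDl// mulr_ge0// ltW.
  (* [interior_holder] asks for [M > 0] while [N] may vanish: [N] is enlarged by an amount that
     contributes at most the arbitrary [e]. *)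
  pose M := N + e / (C * (h `^ alpha) + 1).
  have M0 : 0 < M by rewrite ltr_wpDl// divr_gt0.
  have := H f M h M0 (powR_gt0 _ d0) _ z' z Uz' Uz; rewrite h6 => /(_ _ d1 d2) K.
  apply: (le_trans (K _)).
    move=> y Uy; split; first exact: classical_solves_at Ha Hf _ Uy.
    by apply: (le_trans (fbound _ Uy)); rewrite lerDl ltW// divr_gt0.
  have : e / (C * h `^ alpha + 1) * (C * h `^ alpha) <= e.
    by rewrite mulrAC ler_pdivrMr// ler_pM2l// lerDl.
  rewrite /M; lra.
(* If the norm is infinite, so is the right-hand side. *)
- by rewrite gt0_muley ?leey// lte_fin; lra.
Qed.
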